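(* Let $(a,B)$ be the coefficients of the quadratic vector equation $x=a+B(x\otimes x)$ of a supercritical positive regular Markovian binary tree (SPR-MBT), and let $x^{\ast}$ be its minimal nonnegative solution. Let $\hat x\in\mathbb{R}^n$ (an approximate solution) satisfy $$0\le\hat x<e,\qquad \rho\big(B(\hat x\otimes I+I\otimes\hat x)\big)<1,$$ and put $r=\hat x-a-B(\hat x\otimes\hat x)$, $\gamma=\|r\|$, $\widehat L=I-B(\hat x\otimes I+I\otimes\hat x)$, $\hat\ell=\|\widehat L^{-1}\|$, $b=\|B\|$. If $$1-4\hat\ell^2 b\gamma\ge 0$$ and $$\sqrt{1-4\hat\ell^2 b\gamma}>\max\{1-2\hat\ell b(1-\|e-\hat x\|),\;1-2\hat\ell b(1-\|\hat x\|)\},$$ then $$\|\hat x-x^{\ast}\|\le\frac{2\hat\ell\gamma}{1+\sqrt{1-4\hat\ell^2 b\gamma}}.$$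
   Context: Notation: $\|\cdot\|$ is the infinity norm of vectors and the induced infinity norm (maximum absolute row sum) of matrices; $\rho$ is the spectral radius; $e\in\mathbb{R}^n$ is the all-ones vector; $I$ is the $n\times n$ identity; $\otimes$ is the Kronecker product (so $x\otimes I$ and $I\otimes x$ are $n^2\times n$ for $x\in\mathbb{R}^n$); inequalities between vectors or matrices are entrywise. A Markovian binary tree (MBT) on $n$ states enters only through the coefficients $a\in\mathbb{R}^n$, $B\in\mathbb{R}^{n\times n^2}$ of its quadratic vector equation (QVE) $x=a+B(x\otimes x)$, $x\in\mathbb{R}^n$. These satisfy: (P1) all entries of $a$ and $B$ lie between $0$ and $1$; (P2) $e=a+B(e\otimes e)$. The MBT is supercritical and positive regular (an SPR-MBT) if moreover (P3) the nonnegative $n\times n$ matrix $R=B(I\otimes e+e\otimes I)$ is irreducible and $\rho(R)>1$. The extinction probability $x^{\ast}$ of the MBT is the minimal nonnegative solution of the QVE, i.e. the solution $x^{\ast}\ge 0$ with $x^{\ast}\le y$ for every solution $y\ge0$. For an SPR-MBT it is known that $0\le x^{\ast}<e$ and that $x^{\ast}$ is the only solution of the QVE in $\{x: 0\le x<e\}$. *)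

(* Defs.v *)
From HB Require Import structures.
From mathcomp Require Import all_boot all_order all_algebra.
From mathcomp Require Import complex mxtens.
From mathcomp Require Import all_classical all_reals all_analysis.

Set Implicit Arguments.
Unset Strict Implicit.
Unset Printing Implicit Defensive.

Import Order.TTheory GRing.Theory Num.Theory.
Import numFieldNormedType.Exports.

Local Open Scope classical_set_scope.
Local Open Scope ring_scope.

Definition entrywise_le (R : realType) m n (A B : 'M[R]_(m, n)) : Prop :=
  forall i j, A i j <= B i j.

Definition entrywise_lt (R : realType) m n (A B : 'M[R]_(m, n)) : Prop :=
  forall i j, A i j < B i j.

Definition ones (R : realType) n : 'cV[R]_n := const_mx 1.

(* The infinity norm of a vector is the library norm `|x|.  On matrices the
   library norm is the largest absolute entry, hence this separate definition
   of the induced infinity norm. *)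
Definition mxnorm_inf (R : realType) m n (A : 'M[R]_(m, n)) : R :=
  \big[Num.max/0]_(i < m) \sum_(j < n) `|A i j|.

(* The eigenvalues are those of A as a complex matrix; sup set0 = 0 gives the
   value 0 when n = 0. *)
Definition spectral_radius (R : realType) n (A : 'M[R]_n) : R :=
  sup [set ComplexField.Normc.normc z
      | z in [set z : R[i]%C | eigenvalue (map_mx (real_complex R) A) z]].

(* Reducibility is simultaneous row and column permutability to block
   triangular form with two nonempty diagonal blocks, S being the set of
   indices of one of them. *)
Definition reducible_matrix (R : realType) n (A : 'M[R]_n) : Prop :=
  exists S : {set 'I_n}, [/\ S != finset.set0, S != [set: 'I_n]%SET &
    forall i j, i \in S -> j \notin S -> A i j = 0].

Definition irreducible_matrix (R : realType) n (A : 'M[R]_n) : Prop :=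
  ~ reducible_matrix A.

(* tensmx is the Kronecker product; the casts identify 1 * n and n * 1 with n
   (1 * 1 is convertible to 1). *)
Definition kron_vv (R : realType) n (x y : 'cV[R]_n) : 'cV[R]_(n * n) :=
  tensmx x y.

Definition kron_vI (R : realType) n (x : 'cV[R]_n) : 'M[R]_(n * n, n) :=
  castmx (erefl _, mul1n n) (tensmx x (1%:M : 'M[R]_n)).

Definition kron_Iv (R : realType) n (x : 'cV[R]_n) : 'M[R]_(n * n, n) :=
  castmx (erefl _, muln1 n) (tensmx (1%:M : 'M[R]_n) x).

Definition qve_sol (R : realType) n (a : 'cV[R]_n) (B : 'M[R]_(n, n * n))
    (x : 'cV[R]_n) : Prop :=
  x = a + B *m kron_vv x x.

Record mbt (R : realType) n (a : 'cV[R]_n) (B : 'M[R]_(n, n * n)) : Prop := {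
  mbt_a01 : forall i j, 0 <= a i j <= 1;
  mbt_B01 : forall i j, 0 <= B i j <= 1;
  mbt_ones : qve_sol a B (ones R n) }.

Definition mean_mx (R : realType) n (B : 'M[R]_(n, n * n)) : 'M[R]_n :=
  B *m (kron_Iv (ones R n) + kron_vI (ones R n)).

Record spr_mbt (R : realType) n (a : 'cV[R]_n) (B : 'M[R]_(n, n * n)) :
    Prop := {
  spr_mbt_mbt : mbt a B;
  spr_mbt_irr : irreducible_matrix (mean_mx B);
  spr_mbt_rho : 1 < spectral_radius (mean_mx B) }.

Definition minimal_nonneg_sol (R : realType) n (a : 'cV[R]_n)
    (B : 'M[R]_(n, n * n)) (x : 'cV[R]_n) : Prop :=
  [/\ entrywise_le 0 x, qve_sol a B x &
      forall y : 'cV[R]_n, entrywise_le 0 y -> qve_sol a B y -> entrywise_le x y].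

(* Main.v *)
(* Write x = xh + h and P(x, y) = B (x (x) y).  Then x solves the QVE iff h is a
   fixed point of G(h) = Lh^-1 (P(h, h) - r).  The iterates of G from 0 are
   majorized by those of t |-> l gamma + l b t^2 from 0, which increase to at
   most its smaller fixed point s = 2 l gamma / (1 + sqrt(1 - 4 l^2 b gamma));
   hence G has a fixed point of norm at most s, even in the limiting case of a
   zero discriminant, where G need not be a contraction.  The remaining
   hypothesis says s < 1 - |e - xh| and s < 1 - |xh|, so that 0 <= xh + h < e,
   and xs is the only solution in that range. *)
Require Import Defs.
From HB Require Import structures.
From mathcomp Require Import all_boot all_order all_algebra.
From mathcomp Require Import complex mxtens.
From mathcomp Require Import all_classical all_reals all_analysis.
From mathcomp Require Import ring lra.

Set Implicit Arguments.
Unset Strict Implicit.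
Unset Printing Implicit Defensive.

Import Order.TTheory GRing.Theory Num.Theory.
Import numFieldNormedType.Exports.

Local Open Scope ring_scope.

(** * Fixed points by a quadratic majorant *)

(** The increments of the iterates of [G] from 0 are dominated by those of a bounded increasing
    scalar sequence, so the iterates are Cauchy. The condition on [s] admits a double root, where
    the Lipschitz bound on the ball of radius [s] reaches 1 and contraction fails as an argument. *)
Lemma quadratic_fixed_point (R : realType) (m n : nat)
    (G : 'M[R]_(m, n) -> 'M[R]_(m, n)) (c q s : R) :
  0 <= q -> 0 <= s -> c + q * s ^+ 2 <= s -> `|G 0| <= c ->
  (forall x y, `|G x - G y| <= q * (`|x| + `|y|) * `|x - y|) ->
  exists2 h, G h = h & `|h| <= s.
Proof.
move=> q0 s0 cqs Gc GL.
pose t k := iter k (fun z => c + q * z ^+ 2) 0.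
pose u k := iter k G 0.
have c0 : 0 <= c by apply: le_trans Gc.
have tS k : t k.+1 = c + q * t k ^+ 2 by [].
have uS k : u k.+1 = G (u k) by [].
have tb k : 0 <= t k <= s.
  elim: k => [|k /andP[IH0 IHs]]; first by rewrite lexx.
  rewrite tS addr_ge0 ?mulr_ge0 ?exprn_ge0 //=; apply: le_trans cqs.
  by rewrite lerD2l ler_wpM2l // lerXn2r.
have t0 k : 0 <= t k by case/andP: (tb k).
have ts k : t k <= s by case/andP: (tb k).
(* With norms and increments of [u] bounded by those of [t], the Lipschitz bound becomes
   [q * (t k.+1 + t k) * (t k.+1 - t k)], exactly the next increment of [t]. *)
have ut k : `|u k| <= t k /\ `|u k.+1 - u k| <= t k.+1 - t k.
  elim: k => [|k [IHu IHd]].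
    by rewrite normr0 subr0 tS expr0n /= mulr0 addr0 subr0; split.
  have uk1 : `|u k.+1| <= t k.+1.
    rewrite -[u k.+1](subrK (u k)); apply: le_trans (ler_normD _ _) _.
    by apply: le_trans (lerD IHd IHu) _; rewrite subrK.
  split=> //; rewrite (uS k.+1) {2}(uS k); apply: le_trans (GL _ _) _.
  have -> : t k.+2 - t k.+1 = q * (t k.+1 + t k) * (t k.+1 - t k).
    by rewrite (tS k.+1) {2}(tS k); ring.
  apply: ler_pM => //; first by rewrite mulr_ge0 // addr_ge0.
  by apply: ler_wpM2l => //; apply: lerD.
have tmono : {homo t : i j / (i <= j)%N >-> i <= j}.
  apply/nondecreasing_seqP => k; have [_ H] := ut k.
  by rewrite -subr_ge0; apply: le_trans H.
have utm k j : (k <= j)%N -> `|u j - u k| <= t j - t k.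
  move=> /subnK <-; elim: (j - k)%N => [|i IH]; first by rewrite !subrr normr0.
  have [_ H] := ut (i + k)%N.
  rewrite addSn -[u (i + k).+1](subrK (u (i + k)%N)) -addrA.
  apply: le_trans (ler_normD _ _) _.
  by apply: le_trans (lerD H IH) _; rewrite addrA subrK.
have tcvg : cvgn t.
  by apply: nondecreasing_is_cvgn => //; exists s => _ [k _ <-].
have ucvg : cvgn u.
  apply/cauchy_cvgP/cauchy_exP => e e0.
  have [N _ HN] := cvgr_dist_lt _ _ tcvg _ e0.
  exists (u N), N => // j /= Nj.
  rewrite mx_norm_ball /ball_ /= distrC; apply: le_lt_trans (utm _ _ Nj) _.
  apply: le_lt_trans (HN N (leqnn N)); apply: le_trans (ler_norm _).
  by rewrite lerD2r; apply: nondecreasing_cvgn_le.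
pose h := limn u.
have uh : (u k @[k --> \oo] --> h)%classic by [].
have hs : `|h| <= s.
  apply: (ler_cvg_to (cvg_norm uh) (cvg_cst s)).
  by near=> k; apply: le_trans (ts k); case: (ut k).
exists h => //.
(* Continuity along the iterates comes from the Lipschitz bound, since the [u k] and [h] all have
   norm at most [s]. *)
have uGh : (u k.+1 @[k --> \oo] --> G h)%classic.
  apply/subr_cvg0/norm_cvg0P.
  apply: (@squeeze_cvgr _ _ _ _ (fun=> 0) (fun k => q * (s + s) * `|u k - h|)).
  - near=> k; rewrite normr_ge0 /=; apply: le_trans (GL _ _) _.
    rewrite ler_wpM2r // ler_wpM2l // lerD //.
    by apply: le_trans (ts k); case: (ut k).
  - exact: cvg_cst.
  - rewrite -[X in (_ --> X)%classic](mulr0 (q * (s + s))).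
    by apply: cvgM; [exact: cvg_cst|exact/norm_cvg0P/subr_cvg0].
apply: (cvg_unique (@norm_hausdorff _ _) uGh).
by move: uh; rewrite -(cvg_shiftS u).
Unshelve. all: by end_near.
Qed.

(** * Infinity norms *)

Lemma mx_norm_leP (R : realType) (m n : nat) (A : 'M[R]_(m, n)) (c : R) :
  0 <= c -> reflect (forall i j, `|A i j| <= c) (`|A| <= c).
Proof.
move=> c0; rewrite [`|A|]mx_normrE; apply: (iffP idP) => [Ac i j|Ac].
  apply: le_trans Ac; rewrite -[`|A i j|]/`|A (i, j).1 (i, j).2|.
  exact: (le_bigmax _ (fun p : 'I_m * 'I_n => `|A p.1 p.2|) (i, j)).
by apply: bigmax_le => // -[i j] _ /=.
Qed.

Lemma entry_le_mx_norm (R : realType) (m n : nat) (A : 'M[R]_(m, n)) i j :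
  `|A i j| <= `|A|.
Proof. by move: i j; apply/mx_norm_leP. Qed.

Lemma mxnorm_inf_ge0 (R : realType) (m n : nat) (A : 'M[R]_(m, n)) :
  0 <= mxnorm_inf A.
Proof. exact: bigmax_ge_id. Qed.

Lemma mx_norm_mulmx_le (R : realType) (m n : nat) (A : 'M[R]_(m, n))
    (x : 'cV[R]_n) :
  `|A *m x| <= mxnorm_inf A * `|x|.
Proof.
apply/mx_norm_leP => [|i j]; first by rewrite mulr_ge0 ?mxnorm_inf_ge0.
rewrite mxE; apply: le_trans (ler_norm_sum _ _ _) _.
apply: (@le_trans _ _ ((\sum_k `|A i k|) * `|x|)); last first.
  by rewrite ler_wpM2r // (le_bigmax _ (fun i => \sum_k `|A i k|)).
rewrite mulr_suml; apply: ler_sum => k _; rewrite normrM.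
by rewrite ler_wpM2l // entry_le_mx_norm.
Qed.

(** * Kronecker products and the bilinear form *)

Lemma kron_vvE (R : realType) (n : nat) (x y : 'cV[R]_n) k :
  kron_vv x y k 0 = x (mxtens_unindex k).1 0 * y (mxtens_unindex k).2 0.
Proof. by rewrite /kron_vv mxE; congr (x _ _ * y _ _); apply/ord1. Qed.

Lemma mx_norm_kron_vv_le (R : realType) (n : nat) (x y : 'cV[R]_n) :
  `|kron_vv x y| <= `|x| * `|y|.
Proof.
apply/mx_norm_leP => [|k j]; first exact: mulr_ge0.
by rewrite ord1 kron_vvE normrM ler_pM // entry_le_mx_norm.
Qed.

Lemma kron_vvDl (R : realType) (n : nat) (x y z : 'cV[R]_n) :
  kron_vv (x + y) z = kron_vv x z + kron_vv y z.
Proof.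
by apply/matrixP => k j; rewrite ord1 !(kron_vvE, mxE) mulrDl.
Qed.

Lemma kron_vvDr (R : realType) (n : nat) (x y z : 'cV[R]_n) :
  kron_vv z (x + y) = kron_vv z x + kron_vv z y.
Proof.
by apply/matrixP => k j; rewrite ord1 !(kron_vvE, mxE) mulrDr.
Qed.

Lemma kron_vvNl (R : realType) (n : nat) (x y : 'cV[R]_n) :
  kron_vv (- x) y = - kron_vv x y.
Proof.
by apply/matrixP => k j; rewrite ord1 !(kron_vvE, mxE) mulNr.
Qed.

Lemma kron_vvNr (R : realType) (n : nat) (x y : 'cV[R]_n) :
  kron_vv x (- y) = - kron_vv x y.
Proof.
by apply/matrixP => k j; rewrite ord1 !(kron_vvE, mxE) mulrN.
Qed.

Lemma kron_vI_mul (R : realType) (n : nat) (x y : 'cV[R]_n) :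
  kron_vI x *m y = kron_vv x y.
Proof.
apply/matrixP => k j; rewrite ord1 kron_vvE mxE.
(* In row [k] the identity factor leaves only the column given by the second component of [k]; the
   casts change the type of an index but not its value. *)
rewrite (bigD1 (mxtens_unindex k).2) //= big1 ?addr0 => [|i ik].
  rewrite castmxE /= cast_ord_id mxE.
  set c := cast_ord _ _.
  have -> : (mxtens_unindex c).1 = 0 by exact: ord1.
  have -> : (mxtens_unindex c).2 = (mxtens_unindex k).2.
    by apply: val_inj => /=; rewrite modn_mod.
  by rewrite mxE eqxx mulr1.
rewrite castmxE /= cast_ord_id mxE mxE.
set c := cast_ord _ _.
have -> : (mxtens_unindex c).2 = i.
  by apply: val_inj => /=; rewrite modn_small.
by rewrite eq_sym (negPf ik) mulr0 mul0r.
Qed.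

Lemma kron_Iv_mul (R : realType) (n : nat) (x y : 'cV[R]_n) :
  kron_Iv x *m y = kron_vv y x.
Proof.
apply/matrixP => k j; rewrite ord1 kron_vvE mxE.
rewrite (bigD1 (mxtens_unindex k).1) //= big1 ?addr0 => [|i ik].
  rewrite castmxE /= cast_ord_id mxE.
  set c := cast_ord _ _.
  have -> : (mxtens_unindex c).2 = 0 by exact: ord1.
  have -> : (mxtens_unindex c).1 = (mxtens_unindex k).1.
    by apply: val_inj => /=; rewrite divn1.
  by rewrite mxE eqxx mul1r mulrC.
rewrite castmxE /= cast_ord_id mxE mxE.
set c := cast_ord _ _.
have -> : (mxtens_unindex c).1 = i.
  by apply: val_inj => /=; rewrite divn1.
by rewrite eq_sym (negPf ik) !mul0r.
Qed.

(** Identifies [B *m (kron_vI x + kron_Iv x)] as the derivative at [x] of [z |-> B *m kron_vv z z],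
    so that [Lh] is the Newton matrix at [xh]. *)
Lemma mul_kronD (R : realType) (n : nat) (B : 'M[R]_(n, n * n))
    (x y : 'cV[R]_n) :
  B *m (kron_vI x + kron_Iv x) *m y = B *m kron_vv x y + B *m kron_vv y x.
Proof. by rewrite -mulmxA mulmxDl kron_vI_mul kron_Iv_mul mulmxDr. Qed.

(** * Invertibility from the spectral radius, and uniqueness below [ones] *)

(** A left kernel vector of [1%:M - A] is an eigenvector of [A] for the eigenvalue 1, which puts 1
    in the set whose supremum is taken. *)
Lemma spectral_radius_lt1_unitmx (R : realType) (n : nat) (A : 'M[R]_n) :
  spectral_radius A < 1 -> 1%:M - A \in unitmx.
Proof.
apply: contraTT; rewrite unitmxE unitfE negbK -leNgt => /det0P[v v0 vA].
apply: ub_le_sup; last first.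
  exists 1; last exact: ComplexField.Normc.normc1.
  apply/eigenvalueP; exists (map_mx (real_complex R) v).
    rewrite -map_mxM scale1r; congr map_mx; apply/eqP.
    by rewrite eq_sym -subr_eq0 -{1}[v]mulmx1 -mulmxBr vA.
  by rewrite map_mx_eq0.
(* The supremum dominates the set only if the set is bounded: the sum of the moduli of all roots of
   the characteristic polynomial is a bound. *)
pose p := char_poly (map_mx (real_complex R) A).
have [rs prs] := closed_field_poly_normal (p : {poly R[i]%C}).
exists (\sum_(z <- rs) ComplexField.Normc.normc z) => _ [z zA <-].
have zrs : z \in rs.
  move: zA; rewrite /= eigenvalue_root_char -/p prs rootZ ?root_prod_XsubC //.
  by rewrite lead_coef_eq0 monic_neq0 ?char_poly_monic.
rewrite (big_rem _ zrs) /= lerDl; apply: sumr_ge0 => -[b c] _.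
exact: sqrtr_ge0.
Qed.

(* Measuring x - xs in units of 1 - xs, the largest ratio is attained at a row
   of B that must vanish, which forces x = a = 1 there. *)
Lemma qve_sol_lt_ones_unique (R : realType) (n : nat) (a : 'cV[R]_n)
    (B : 'M[R]_(n, n * n)) (xs x : 'cV[R]_n) :
  (forall i j, 0 <= B i j) -> qve_sol a B (ones R n) ->
  entrywise_le 0 xs -> entrywise_le xs x -> entrywise_lt x (ones R n) ->
  qve_sol a B xs -> qve_sol a B x -> x = xs.
Proof.
move=> B0 e_sol xs0 xs_x x1 xs_sol x_sol.
apply/eqP/negP => /negP xxs.
pose d i := x i 0 - xs i 0; pose u i := 1 - xs i 0.
have xlt1 i : x i 0 < 1 by have := x1 i 0; rewrite mxE.
have xsge0 i : 0 <= xs i 0 by have := xs0 i 0; rewrite mxE.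
have d_ge0 i : 0 <= d i by rewrite subr_ge0.
have du i : d i < u i by rewrite ltrD2r.
have u_gt0 i : 0 < u i by apply: le_lt_trans (du i).
have [i0 di0] : exists i, 0 < d i.
  apply: contrapT => /forallNP d0; move/negP: xxs; apply.
  apply/eqP/matrixP => i j; rewrite ord1; apply/eqP.
  rewrite -subr_eq0 eq_le d_ge0 andbT leNgt; exact/negP/d0.
pose f i := d i / u i.
case: (@Order.TotalTheory.arg_maxP _ _ _ i0 xpredT f erefl) => i _ imax.
have s_gt0 : 0 < f i by apply: lt_le_trans (imax i0 _) => //; rewrite divr_gt0.
have s_lt1 : f i < 1 by rewrite ltr_pdivrMr ?mul1r.
have d_le j : d j <= f i * u j by rewrite -ler_pdivrMr //; apply: imax.
have diE : d i = f i * u i by rewrite divfK // gt_eqF.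
have solE (y : 'cV[R]_n) : qve_sol a B y -> \sum_k B i k *
    (y (mxtens_unindex k).1 0 * y (mxtens_unindex k).2 0) = y i 0 - a i 0.
  move=> y_sol; have -> : y i 0 = a i 0 + (B *m kron_vv y y) i 0.
    by rewrite {1}y_sol mxE.
  rewrite addrC addKr mxE.
  by apply: eq_bigr => k _; rewrite kron_vvE.
pose w k := f i * (1 - xs (mxtens_unindex k).1 0 * xs (mxtens_unindex k).2 0) -
  (x (mxtens_unindex k).1 0 * x (mxtens_unindex k).2 0 -
   xs (mxtens_unindex k).1 0 * xs (mxtens_unindex k).2 0).
have w_gt0 k : 0 < w k.
  rewrite /w; set p := (mxtens_unindex k).1; set q := (mxtens_unindex k).2.
  (* Substitute [x = xs + d] and [1 = xs + u]. Maximality of [f i] makes the first three terms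
     nonnegative; [0 < f i < 1] makes the last one positive. *)
  have -> : f i * (1 - xs p 0 * xs q 0) - (x p 0 * x q 0 - xs p 0 * xs q 0) =
      xs p 0 * (f i * u q - d q) + xs q 0 * (f i * u p - d p) +
      (f i * u p * (f i * u q) - d p * d q) + f i * (1 - f i) * (u p * u q).
    by rewrite /u /d; ring.
  apply: ltr_wpDl.
    apply: addr_ge0; last by rewrite subr_ge0 ler_pM.
    by apply: addr_ge0; apply: mulr_ge0; rewrite ?subr_ge0.
  by rewrite mulr_gt0 ?(mulr_gt0 s_gt0) ?(mulr_gt0 (u_gt0 _)) // subr_gt0.
(* Row [i] of the equations for [ones], [x] and [xs] combines to [f i * u i - d i], zero by
   definition of [f]. As every [w k] is positive, the row must vanish. *)
have sumw0 : \sum_k B i k * w k = 0.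
  have -> : \sum_k B i k * w k = f i * u i - d i; last by rewrite diE subrr.
  have -> : u i = (ones R n i 0 - a i 0) - (xs i 0 - a i 0).
    by rewrite mxE opprB addrA subrK.
  have -> : d i = (x i 0 - a i 0) - (xs i 0 - a i 0) by rewrite opprB addrA subrK.
  rewrite -!solE // -!sumrB mulr_sumr -sumrB; apply: eq_bigr => k _.
  by rewrite /w !mxE; ring.
have Bi0 k : B i k = 0.
  have Bw_ge0 j : true -> 0 <= B i j * w j by move=> _; rewrite mulr_ge0 // ltW.
  have /eqP : B i k * w k = 0 by exact: (psumr_eq0P Bw_ge0 sumw0).
  by rewrite mulf_eq0 (gt_eqF (w_gt0 k)) orbF => /eqP.
have solE0 (y : 'cV[R]_n) : qve_sol a B y -> y i 0 = a i 0.
  move/solE => yE; apply/eqP; rewrite -subr_eq0 -yE big1 // => k _.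
  by rewrite Bi0 mul0r.
by have := xlt1 i; rewrite (solE0 _ x_sol) -(solE0 _ e_sol) mxE ltxx.
Qed.

(** * The error bound *)

Theorem theorem2p2 (R : realType) (n : nat)
    (a : 'cV[R]_n) (B : 'M[R]_(n, n * n)) (xs xh : 'cV[R]_n)
    (hspr : spr_mbt a B)
    (hxs : minimal_nonneg_sol a B xs)
    (hxh0 : entrywise_le 0 xh)
    (hxh1 : entrywise_lt xh (ones R n))
    (hrho : spectral_radius (B *m (kron_vI xh + kron_Iv xh)) < 1) :
  let r := xh - a - B *m kron_vv xh xh in
  let gamma := `|r| in
  let Lh := 1%:M - B *m (kron_vI xh + kron_Iv xh) in
  let l := mxnorm_inf (invmx Lh) in
  let b := mxnorm_inf B in
  0 <= 1 - 4 * l ^+ 2 * b * gamma ->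
  Num.max (1 - 2 * l * b * (1 - `|ones R n - xh|))
          (1 - 2 * l * b * (1 - `|xh|))
    < Num.sqrt (1 - 4 * l ^+ 2 * b * gamma) ->
  `|xh - xs| <= 2 * l * gamma / (1 + Num.sqrt (1 - 4 * l ^+ 2 * b * gamma)).
Proof.
case: hspr => -[_ B01 e_sol] _ _.
case: hxs => xs_ge0 xs_sol xs_min.
move=> r gamma Lh l b D_ge0; rewrite gt_max => /andP[cond1 cond2].
set S := Num.sqrt _ in cond1 cond2 *.
have S0 : 0 <= S by exact: sqrtr_ge0.
have SE : S ^+ 2 = 1 - 4 * l ^+ 2 * b * gamma by rewrite sqr_sqrtr.
have l0 : 0 <= l by exact: mxnorm_inf_ge0.
have b0 : 0 <= b by exact: mxnorm_inf_ge0.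
have g0 : 0 <= gamma by exact: normr_ge0.
(* If [l * b] were 0, then [S = 1] and [cond1] would read [1 < 1]. *)
have lb_gt0 : 0 < l * b.
  rewrite lt0r mulr_ge0 // andbT; apply/eqP => lb0.
  have S1 : S = 1.
    apply/eqP; rewrite -sqrp_eq1 // SE expr2 !mulrA -(mulrA _ l b) lb0.
    by rewrite !mulr0 mul0r subr0.
  by move: cond1; rewrite S1 -(mulrA 2) lb0 mulr0 mul0r subr0 ltxx.
pose s := 2 * l * gamma / (1 + S).
have sE : s * (1 + S) = 2 * l * gamma by rewrite divfK // gt_eqF //; lra.
have s0 : 0 <= s by rewrite divr_ge0 ?mulr_ge0 //; lra.
(* The rationalized [s] is the smaller root [(1 - S) / (2 l b)]; this turns [1 - 2 l b (1 - N) < S]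
   into [s < 1 - N]. *)
have lbs : 2 * (l * b) * s = 1 - S.
  apply: (@mulIf _ (1 + S)); first by rewrite gt_eqF //; lra.
  transitivity (2 * (l * b) * (s * (1 + S))); first by ring.
  transitivity (1 - S ^+ 2); last by ring.
  by rewrite sE SE; ring.
have s_fix : l * gamma + l * b * s ^+ 2 = s.
  apply: (@mulfI _ 2); first by rewrite pnatr_eq0.
  transitivity (2 * l * gamma + 2 * (l * b) * s * s); first by ring.
  by rewrite lbs -sE; ring.
have s_lt N : 1 - 2 * l * b * (1 - N) < S -> s < 1 - N.
  by move=> HN; rewrite -(ltr_pM2l lb_gt0); lra.
have Lu : Lh \in unitmx by exact: spectral_radius_lt1_unitmx.
pose G (h : 'cV[R]_n) := invmx Lh *m (B *m kron_vv h h - r).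
have [|||||h Gh hs] := @quadratic_fixed_point _ _ _ G (l * gamma) (l * b) s.
- exact: ltW.
- by [].
- by rewrite s_fix.
- apply: le_trans (mx_norm_mulmx_le _ _) _; rewrite ler_wpM2l //.
  have -> : kron_vv (0 : 'cV[R]_n) 0 = 0.
    by apply/matrixP => i j; rewrite ord1 kron_vvE !mxE mulr0.
  by rewrite mulmx0 sub0r normrN.
- move=> x y; rewrite /G -mulmxBr; apply: le_trans (mx_norm_mulmx_le _ _) _.
  rewrite -!mulrA ler_wpM2l //.
  have -> : B *m kron_vv x x - r - (B *m kron_vv y y - r) =
      B *m (kron_vv x x - kron_vv y y) by rewrite (opprB _ r) addrA subrK mulmxBr.
  apply: le_trans (mx_norm_mulmx_le _ _) _; rewrite ler_wpM2l //.
  have -> : kron_vv x x - kron_vv y y = kron_vv x (x - y) + kron_vv (x - y) y.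
    by rewrite kron_vvDr kron_vvDl kron_vvNr kron_vvNl addrA subrK.
  apply: le_trans (ler_normD _ _) _.
  apply: le_trans (lerD (mx_norm_kron_vv_le _ _) (mx_norm_kron_vv_le _ _)) _.
  by rewrite mulrDl [X in _ + X <= _]mulrC.
(* Multiply the fixed point equation by [Lh]: the terms of [Lh *m h] supply the cross terms in the
   expansion of the Kronecker square of [xh + h]. *)
have x_sol : qve_sol a B (xh + h).
  have : Lh *m h = B *m kron_vv h h - r by rewrite -{1}Gh mulKVmx.
  rewrite mulmxBl mul1mx mul_kronD => Lhh.
  rewrite /qve_sol kron_vvDl !kron_vvDr !mulmxDr.
  apply/matrixP => i j; move/matrixP/(_ i j): Lhh; rewrite /r.
  set p := B *m kron_vv xh h; set q := B *m kron_vv h xh.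
  set t := B *m kron_vv h h; set w := B *m kron_vv xh xh.
  by rewrite !mxE; lra.
have hi i : `|h i 0| <= s by apply: le_trans hs; exact: entry_le_mx_norm.
(* Each [xh i 0] is at least [1 - |e - xh|], which exceeds [s], while [h i 0] is at least [- s]. *)
have x_ge0 : entrywise_le 0 (xh + h).
  move=> i j; rewrite ord1 !mxE.
  have := entry_le_mx_norm (ones R n - xh) i 0; rewrite !mxE.
  have := ler_norm (1 - xh i 0); have := hi i; rewrite ler_norml => /andP[+ _].
  by have := s_lt _ cond1; lra.
have x_lt1 : entrywise_lt (xh + h) (ones R n).
  move=> i j; rewrite ord1 !mxE.
  have := entry_le_mx_norm xh i 0; have := ler_norm (xh i 0).
  by have := le_trans (ler_norm _) (hi i); have := s_lt _ cond2; lra.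
have B_ge0 i j : 0 <= B i j by case/andP: (B01 i j).
(* Minimality of [xs] provides the ordering [xs <= xh + h] on which the uniqueness lemma relies. *)
have <- := qve_sol_lt_ones_unique B_ge0 e_sol xs_ge0 (xs_min _ x_ge0 x_sol)
  x_lt1 xs_sol x_sol.
by rewrite opprD addrA subrr sub0r normrN.
Qed.
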